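(* Let $\mathcal{H}$ be a finite-dimensional Hilbert space, and let $(g_k)_{k=1}^M$ and $(f_i)_{i=1}^N$ be two frames for $\mathcal{H}$, with canonical dual frames $(\tilde g_k)_{k=1}^M$ and $(\tilde f_i)_{i=1}^N$ respectively. Let $G$ be the $N\times M$ cross-Gram matrix with entries $G_{j,m}=\langle \tilde g_m, f_j\rangle$, $1\le j\le N$, $1\le m\le M$. Then (multiplication by) $G$ maps $\operatorname{ran}(C_{g})$ bijectively onto $\operatorname{ran}(C_{f})$, in such a way that for every $f\in\mathcal{H}$ $$ \left(\langle f,g_k\rangle\right)_{k=1}^M \mapsto \left(\langle f,f_i\rangle\right)_{i=1}^N ,$$ and for every $f\in\mathcal{H}$ $$ f=\sum_{i=1}^M \langle f,g_i\rangle\,\tilde g_i=\sum_{i=1}^N \left(G\cdot\left(\langle f,g_k\rangle\right)_{k=1}^M\right)_i\,\tilde f_i .$$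
   Context: Hilbert spaces are over $\mathbb{K}=\mathbb{R}$ or $\mathbb{C}$, and the inner product $\langle\cdot,\cdot\rangle$ is linear in the first argument. A finite family $(h_k)_{k=1}^L$ in $\mathcal{H}$ is a frame for $\mathcal{H}$ if there are constants $A,B>0$ with $A\|f\|^2\le\sum_{k=1}^L|\langle f,h_k\rangle|^2\le B\|f\|^2$ for all $f\in\mathcal{H}$. Its analysis operator is $C_{h}:\mathcal{H}\to\mathbb{K}^L$, $C_{h}(f)=(\langle f,h_k\rangle)_{k=1}^L$, and $\operatorname{ran}(C_h)$ denotes the range of this operator. Its frame operator is $S:\mathcal{H}\to\mathcal{H}$, $S(f)=\sum_{k=1}^L\langle f,h_k\rangle h_k$, which is invertible, and its canonical dual frame is $(\tilde h_k)_{k=1}^L=(S^{-1}h_k)_{k=1}^L$ (each frame uses its own frame operator). *)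

(* Defs.v *)
From HB Require Import structures.
From mathcomp Require Import all_boot all_order all_algebra.
From mathcomp Require Import sesquilinear.
From mathcomp Require Import complex.
From mathcomp Require Import classical_sets functions reals.

Set Implicit Arguments.
Unset Strict Implicit.
Unset Printing Implicit Defensive.

Import Order.TTheory GRing.Theory Num.Theory.
Local Open Scope ring_scope.

Variant scalars := RealScalars | ComplexScalars.

Definition scalar_field (R : realType) (k : scalars) : numFieldType :=
  match k with
  | RealScalars => R
  | ComplexScalars => R[i]
  end.

Definition scalar_conj (R : realType) (k : scalars) :
    scalar_field R k -> scalar_field R k :=
  match k return scalar_field R k -> scalar_field R k with
  | RealScalars => idfun
  | ComplexScalars => fun z : R[i] => Num.conj z
  end.

(* A finite-dimensional Hilbert space is a [vectType] with a positive definite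
   hermitian form; completeness is automatic.  The form [{dot H for theta}] is
   linear in its first argument and [theta]-semilinear in its second. *)
Section Frames.
Context {K : numFieldType} {theta : K -> K} {H : vectType K}.
Variable inner : {dot H for theta}.

(* Over [R[i]], [0 < A] forces [A] to be real, and [`|z|] is the modulus of [z]
   seen as an element of [R[i]]; [inner x x] is the squared norm of [x]. *)
Definition is_frame (L : nat) (h : 'I_L -> H) : Prop :=
  exists A B : K, [/\ 0 < A, 0 < B &
    forall x : H,
      A * inner x x <= \sum_(k < L) `|inner x (h k)| ^+ 2 <= B * inner x x].

Definition analysis (L : nat) (h : 'I_L -> H) (x : H) : 'cV[K]_L :=
  \col_(k < L) inner x (h k).

Definition frame_fun (L : nat) (h : 'I_L -> H) (x : H) : H :=
  \sum_(k < L) inner x (h k) *: h k.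

Lemma frame_fun_is_linear (L : nat) (h : 'I_L -> H) : linear (frame_fun h).
Proof.
move=> a x y; rewrite /frame_fun scaler_sumr -big_split /=.
by apply: eq_bigr => k _; rewrite linearPl scalerDl scalerA.
Qed.

HB.instance Definition _ (L : nat) (h : 'I_L -> H) :=
  GRing.isLinear.Build K H H *:%R (frame_fun h) (frame_fun_is_linear h).

Definition frame_op (L : nat) (h : 'I_L -> H) : 'End(H) :=
  linfun (frame_fun h).

Lemma frame_opE (L : nat) (h : 'I_L -> H) (x : H) :
  frame_op h x = \sum_(k < L) inner x (h k) *: h k.
Proof. exact: lfunE. Qed.

(* [_^-1%VF] is a total operation; it is the two-sided inverse as soon as the
   operator is invertible, which is the case for the frame operator of a
   frame. *)
Definition canonical_dual (L : nat) (h : 'I_L -> H) (k : 'I_L) : H :=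
  (frame_op h)^-1%VF (h k).

Definition cross_gram (M N : nat) (g : 'I_M -> H) (f : 'I_N -> H) :
    'M[K]_(N, M) :=
  \matrix_(j < N, m < M) inner (canonical_dual g m) (f j).

End Frames.

(* Main.v *)
Require Import Defs.
From mathcomp Require Import all_boot all_order all_algebra.
From mathcomp Require Import sesquilinear.
From mathcomp Require Import complex.
From mathcomp Require Import classical_sets functions reals.

Set Implicit Arguments.
Unset Strict Implicit.
Unset Printing Implicit Defensive.

Import Order.TTheory GRing.Theory Num.Theory.
Local Open Scope ring_scope.
Local Open Scope classical_set_scope.

(** A frame expands every vector in its canonical dual: the frame operator [S]
    is injective, because [inner (S x) x] is the sum of the [`|inner x (h k)|^2],
    which the lower frame bound keeps away from [0] when [x] is nonzero
    ([frame_op_injective]); in finite dimension it is then invertible, and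
    applying its inverse to the definition of [S x] gives
    [x = \sum_k inner x (h k) *: canonical_dual h k]
    ([canonical_dual_expansion]).

    Taking the inner product of the expansion in [g] with [f j] is exactly the
    [j]-th row of the product of the cross-Gram matrix with the coefficients of
    [x] ([cross_gram_analysis]), so this matrix intertwines the two analysis
    maps.  A map sending [u x] to [v x] for all [x] is automatically onto the
    range of [v], and it is injective on the range of [u] as soon as [v] is;
    here [v], the analysis map of [f], is injective because the expansion in [f]
    recovers [x] from its coefficients. *)

(** The common ground of the real and the complex case: through this identity
    the theory below covers both at once. *)
Lemma mul_scalar_conj (R : realType) (k : scalars) (z : scalar_field R k) :
  z * scalar_conj z = `|z| ^+ 2.
Proof.
case: k z => z /=; first by rewrite real_normK ?num_real.
by rewrite normCK.
Qed.

Section FrameTheory.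
Context {K : numFieldType} {theta : K -> K} {H : vectType K}.
Variable inner : {dot H for theta}.
Hypothesis mul_theta : forall z : K, z * theta z = `|z| ^+ 2.

(** Links the frame operator to the frame bounds: hermitian symmetry pairs each
    coefficient [inner x (h k)] with its conjugate. *)
Lemma inner_frame_op (L : nat) (h : 'I_L -> H) (x : H) :
  inner (frame_op inner h x) x = \sum_(k < L) `|inner x (h k)| ^+ 2.
Proof.
rewrite frame_opE linear_sumlz.
apply: eq_bigr => k _; rewrite linearZl_LR /= -mul_theta; congr (_ * _).
by rewrite hermitian_subproof expr0 mul1r.
Qed.

Lemma frame_op_injective (L : nat) (h : 'I_L -> H) :
  is_frame inner h -> lker (frame_op inner h) == 0%VS.
Proof.
move=> [A [B [A_gt0 _ bounds]]].
rewrite -subv0; apply/subvP => x; rewrite memv_ker memv0 => /eqP Sx0.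
have /andP[+ _] := bounds x.
rewrite -inner_frame_op Sx0 linear0l; apply: contraTT => x_neq0.
by rewrite lt_geF // mulr_gt0 // neq0_dnorm_gt0.
Qed.

Lemma canonical_dual_expansion (L : nat) (h : 'I_L -> H) (x : H) :
  is_frame inner h ->
  x = \sum_(k < L) inner x (h k) *: canonical_dual inner h k.
Proof.
move=> /frame_op_injective /lker0_lfunK Sk.
rewrite -[LHS]Sk frame_opE linear_sum.
by apply: eq_bigr => k _; rewrite linearZ.
Qed.

Lemma analysis_injective (L : nat) (h : 'I_L -> H) :
  is_frame inner h -> injective (analysis inner h).
Proof.
move=> frame_h x y eq_xy.
rewrite (canonical_dual_expansion x frame_h) (canonical_dual_expansion y frame_h).
by apply: eq_bigr => k _; move/colP: eq_xy => /(_ k); rewrite !mxE => ->.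
Qed.

Lemma cross_gram_analysis (M N : nat) (g : 'I_M -> H) (f : 'I_N -> H) (x : H) :
  is_frame inner g ->
  cross_gram inner g f *m analysis inner g x = analysis inner f x.
Proof.
move=> frame_g; apply/colP => j; rewrite !mxE.
rewrite [in RHS](canonical_dual_expansion x frame_g) linear_sumlz.
by apply: eq_bigr => m _; rewrite !mxE linearZl_LR /= mulrC.
Qed.

End FrameTheory.

Lemma set_bij_range_intertwine (X Y Z : Type) (u : X -> Y) (v : X -> Z)
    (w : Y -> Z) :
  (forall x, w (u x) = v x) -> injective v -> set_bij (range u) (range v) w.
Proof.
move=> wu v_inj; split.
- by move=> _ [x _ <-]; exists x; rewrite ?wu.
- move=> _ _ /set_mem[x _ <-] /set_mem[y _ <-].
  by rewrite !wu => /v_inj->.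
- by move=> _ [x _ <-]; exists (u x); [exists x | rewrite wu].
Qed.

Theorem theorem4p1 (R : realType) (k : scalars)
    (H : vectType (scalar_field R k))
    (inner : {dot H for @scalar_conj R k})
    (M N : nat) (g : 'I_M -> H) (f : 'I_N -> H)
    (hg : is_frame inner g) (hf : is_frame inner f) :
  let G := cross_gram inner g f in
  [/\ set_bij (range (analysis inner g)) (range (analysis inner f))
        (fun c : 'cV[scalar_field R k]_M => G *m c),
      forall x : H, G *m analysis inner g x = analysis inner f x &
      forall x : H,
        x = \sum_(i < M) inner x (g i) *: canonical_dual inner g i /\
        x = \sum_(i < N)
              (G *m analysis inner g x) i ord0 *: canonical_dual inner f i].
Proof.
move=> G.
have Gg x : G *m analysis inner g x = analysis inner f x.
  exact: cross_gram_analysis (@mul_scalar_conj R k) _ _ _ _ _ hg.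
split=> //.
- apply: set_bij_range_intertwine Gg _.
  exact: analysis_injective (@mul_scalar_conj R k) _ _ hf.
- move=> x; split.
    exact: canonical_dual_expansion (@mul_scalar_conj R k) _ _ _ hg.
  rewrite Gg [LHS](canonical_dual_expansion (@mul_scalar_conj R k) x hf).
  by apply: eq_bigr => i _; rewrite mxE.
Qed.
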